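(* Let $\mathcal{X}$ be a complex Banach space with $\dim \mathcal{X}\geq 2$, let $\mathcal{U}\subseteq B(\mathcal{X})$ be a standard operator algebra containing the identity operator $I$, let $n\geq 2$ be a fixed integer, and let $\delta:\mathcal{U}\rightarrow\mathcal{U}$ be a linear derivation. The following are equivalent: (i) $\delta$ is a Lie $n$-centralizer; (ii) $\delta$ satisfies $\mathbf{(T)}$; (iii) $\delta$ satisfies $\mathbf{(T_l)}$; (iv) $\delta$ satisfies $\mathbf{(T_r)}$; (v) $\delta$ satisfies $\mathbf{(N)}$; (vi) $\delta$ satisfies $\mathbf{(N_l)}$; (vii) $\delta$ satisfies $\mathbf{(N_r)}$; (viii) $\delta$ is an $n$-commuting map; (ix) $\delta$ is a commuting map; (x) $\delta$ is a centralizing map; (xi) $\delta=0$.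
   Context: All algebras and vector spaces are over $\mathbb{C}$. For a complex Banach space $\mathcal{X}$, $B(\mathcal{X})$ is the algebra of all bounded linear operators on $\mathcal{X}$ and $F(\mathcal{X})$ is its ideal of finite rank operators. A standard operator algebra over $\mathcal{X}$ is any subalgebra of $B(\mathcal{X})$ containing $F(\mathcal{X})$ (no closedness is assumed). For elements of an algebra $\mathcal{U}$, $[a,b]=ab-ba$, and $p_n$ is defined recursively by $p_1(a_1)=a_1$ and $p_n(a_1,\dots,a_n)=[p_{n-1}(a_1,\dots,a_{n-1}),a_n]$ for $n\geq 2$. $\mathrm{Z}(\mathcal{U})$ denotes the center of $\mathcal{U}$. A linear derivation is a linear map $\delta:\mathcal{U}\to\mathcal{U}$ with $\delta(ab)=a\delta(b)+\delta(a)b$ for all $a,b\in\mathcal{U}$. A map $\varphi:\mathcal{U}\to\mathcal{U}$ is commuting if $[\varphi(a),a]=0$ for all $a\in\mathcal{U}$; centralizing if $[\varphi(a),a]\in \mathrm{Z}(\mathcal{U})$ for all $a\in\mathcal{U}$; and $n$-commuting ($n\geq 2$) if $p_n(\varphi(a),a,\dots,a)=0$ for all $a\in\mathcal{U}$. A linear map $\phi:\mathcal{U}\to\mathcal{U}$ is a Lie $n$-centralizer ($n\geq2$) if $\phi(p_n(a_1,a_2,\dots,a_n))=p_n(\phi(a_1),a_2,\dots,a_n)$ for all $a_1,\dots,a_n\in\mathcal{U}$. For a fixed integer $n\geq 2$ and a linear map $\phi:\mathcal{U}\to\mathcal{U}$, consider the following conditions: - $\mathbf{(T_l)}$: $\phi(p_n(a_1,a_2,\dots,a_n))=p_n(\phi(a_1),a_2,\dots,a_n)$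 for all $a_1,\dots,a_n\in\mathcal{U}$ with $a_1a_2=0$. - $\mathbf{(T_r)}$: $\phi(p_n(a_1,a_2,\dots,a_n))=p_n(a_1,\phi(a_2),a_3,\dots,a_n)$ for all $a_1,\dots,a_n\in\mathcal{U}$ with $a_1a_2=0$. - $\mathbf{(T)}$: both $\mathbf{(T_l)}$ and $\mathbf{(T_r)}$ hold. - $\mathbf{(N_l)}$: $\phi(p_n(a_1,a_2,\dots,a_n))=p_n(\phi(a_1),a_2,\dots,a_n)$ for all $a_1,\dots,a_n\in\mathcal{U}$ with $a_1a_2\cdots a_n=0$. - $\mathbf{(N_r)}$: $\phi(p_n(a_1,a_2,\dots,a_n))=p_n(a_1,\phi(a_2),a_3,\dots,a_n)$ for all $a_1,\dots,a_n\in\mathcal{U}$ with $a_1a_2\cdots a_n=0$. - $\mathbf{(N)}$: both $\mathbf{(N_l)}$ and $\mathbf{(N_r)}$ hold. *)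

(* Defs.v *)
From HB Require Import structures.
From mathcomp Require Import all_boot all_order all_algebra.
From mathcomp Require Import complex.
From mathcomp Require Import boolp classical_sets functions reals.
From mathcomp Require Import topology normedtype.

Set Implicit Arguments.
Unset Strict Implicit.
Unset Printing Implicit Defensive.
Set Warnings "-redundant-canonical-projection,-projection-no-head-constant".

Import Order.TTheory GRing.Theory Num.Theory.
Import numFieldNormedType.Exports.

Local Open Scope ring_scope.

Section LieNotions.
Variable U : pzRingType.
Implicit Types (phi : U -> U) (n : nat).

Definition comm (a b : U) : U := a * b - b * a.

(* The n in p_n is the length of the list; see pn1 and pn_rcons. The empty
   list, on which p_n is not defined, gets the value 0. *)
Definition pn (s : seq U) : U := if s is a :: s' then foldl comm a s' else 0.

Lemma pn1 a : pn [:: a] = a. Proof. by []. Qed.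

Lemma pn_rcons s a : s != [::] -> pn (rcons s a) = comm (pn s) a.
Proof. by case: s => //= b s _; rewrite foldl_rcons. Qed.

Definition center (a : U) : Prop := forall b, a * b = b * a.

Definition derivation phi : Prop :=
  forall a b, phi (a * b) = a * phi b + phi a * b.

Definition commuting phi : Prop := forall a, comm (phi a) a = 0.

Definition centralizing phi : Prop := forall a, center (comm (phi a) a).

Definition n_commuting n phi : Prop :=
  forall a, pn (phi a :: nseq n.-1 a) = 0.

(* Below, linearity of phi is left to the type of the map, and the n elements
   a_1, .., a_n are [:: a1 & s] or [:: a1, a2 & s]. *)
Definition Lie_n_centralizer n phi : Prop :=
  forall (a1 : U) (s : (n.-1).-tuple U),
    phi (pn [:: a1 & s]) = pn [:: phi a1 & s].

Definition Tl n phi : Prop :=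
  forall (a1 a2 : U) (s : (n.-2).-tuple U), a1 * a2 = 0 ->
    phi (pn [:: a1, a2 & s]) = pn [:: phi a1, a2 & s].

Definition Tr n phi : Prop :=
  forall (a1 a2 : U) (s : (n.-2).-tuple U), a1 * a2 = 0 ->
    phi (pn [:: a1, a2 & s]) = pn [:: a1, phi a2 & s].

Definition Nl n phi : Prop :=
  forall (a1 a2 : U) (s : (n.-2).-tuple U),
    \prod_(a <- [:: a1, a2 & s]) a = 0 ->
    phi (pn [:: a1, a2 & s]) = pn [:: phi a1, a2 & s].

Definition Nr n phi : Prop :=
  forall (a1 a2 : U) (s : (n.-2).-tuple U),
    \prod_(a <- [:: a1, a2 & s]) a = 0 ->
    phi (pn [:: a1, a2 & s]) = pn [:: a1, phi a2 & s].

End LieNotions.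

Definition dim_ge (K : pzRingType) (V : lmodType K) (k : nat) : Prop :=
  exists v : 'I_k -> V,
    forall c : 'I_k -> K, \sum_(i < k) c i *: v i = 0 -> forall i, c i = 0.

Section BoundedOperators.
Variables (K : numFieldType) (X : normedModType K).

Definition bounded_operator (f : X -> X) : Prop :=
  exists M : K, forall x, `|f x| <= M * `|x|.

Definition bop_pred : {pred X -> X} :=
  [pred f | `[< linear f /\ bounded_operator f >] ].

Lemma bop_subsemimod_closed : subsemimod_closed bop_pred.
Proof.
split; first split.
- apply/asboolP; split; first by move=> a x y /=; rewrite scaler0 addr0.
  by exists 0 => x /=; rewrite normr0 mul0r.
- move=> f g /asboolP[lf [M hM]] /asboolP[lg [N hN]]; apply/asboolP; split.
    by move=> a x y; rewrite !fctE lf lg scalerDr addrACA.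
  exists (M + N) => x; rewrite !fctE mulrDl.
  by rewrite (le_trans (ler_normD _ _))// lerD.
- move=> a f /asboolP[lf [M hM]]; apply/asboolP; split.
    by move=> b x y; rewrite /= !fctE lf scalerDr !scalerA mulrC.
  exists (`|a| * M) => x; rewrite !fctE normrZ -mulrA.
  by rewrite ler_wpM2l.
Qed.

HB.instance Definition _ :=
  GRing.isSubSemiModClosed.Build K (X -> X) bop_pred bop_subsemimod_closed.

Record bop := BOp { bop_fun :> X -> X ; bopP : bop_fun \in bop_pred }.

HB.instance Definition _ := [isSub for bop_fun].
HB.instance Definition _ := [Choice of bop by <:].
HB.instance Definition _ := [SubChoice_isSubLmodule of bop by <:].

Lemma bop_linear (f : bop) : linear f.
Proof. by have /asboolP[] := bopP f. Qed.

Lemma bop_bounded (f : bop) : bounded_operator f.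
Proof. by have /asboolP[] := bopP f. Qed.

Lemma bop_ext (f g : bop) : f =1 g -> f = g.
Proof. by move=> fg; apply/val_inj/funext. Qed.

HB.instance Definition _ (f : bop) :=
  GRing.isLinear.Build K X X *:%R f (@bop_linear f).

Lemma bop_id_subproof : idfun \in bop_pred.
Proof.
by apply/asboolP; split=> //; exists 1 => x; rewrite mul1r.
Qed.

Lemma bop_comp_subproof (f g : bop) : f \o g \in bop_pred.
Proof.
apply/asboolP; split; first by move=> a x y; rewrite /= !linearP.
have [M hM] := bop_bounded f; have [N hN] := bop_bounded g.
exists (`|M| * N) => x; rewrite /= (le_trans (hM _))//.
have [y0|x0] := eqVneq (g x) 0.
  by rewrite y0 normr0 mulr0 -mulrA mulr_ge0// (le_trans _ (hN x)).
have gx0 : 0 < `|g x| by rewrite normr_gt0.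
have M0 : 0 <= M by rewrite -(pmulr_lge0 _ gx0) (le_trans _ (hM _)).
by rewrite ger0_norm// -mulrA ler_wpM2l.
Qed.

Definition bop_id : bop := BOp bop_id_subproof.
Definition bop_comp (f g : bop) : bop := BOp (bop_comp_subproof f g).

Fact bop_compA : associative bop_comp.
Proof. by move=> f g h; apply: bop_ext. Qed.
Fact bop_comp1f : left_id bop_id bop_comp.
Proof. by move=> f; apply: bop_ext. Qed.
Fact bop_compf1 : right_id bop_id bop_comp.
Proof. by move=> f; apply: bop_ext. Qed.
Fact bop_compDl : left_distributive bop_comp +%R.
Proof. by move=> f g h; apply: bop_ext. Qed.
Fact bop_compDr : right_distributive bop_comp +%R.
Proof. by move=> f g h; apply: bop_ext => x /=; rewrite !linearD. Qed.

HB.instance Definition _ := GRing.Zmodule_isPzRing.Build bop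
  bop_compA bop_comp1f bop_compf1 bop_compDl bop_compDr.

Lemma bopE :
  [/\ forall x, (0 : bop) x = 0, forall x, (1 : bop) x = x,
      forall (f g : bop) x, (f + g) x = f x + g x,
      forall (f g : bop) x, (f * g) x = f (g x) &
      forall a (f : bop) x, (a *: f) x = a *: f x].
Proof. by []. Qed.

Definition finite_rank (f : bop) : Prop :=
  exists (m : nat) (v : 'I_m -> X),
    forall x, exists c : 'I_m -> K, f x = \sum_(i < m) c i *: v i.

Definition subalgebra (A : {pred bop}) : Prop :=
  [/\ 0 \in A,
      {in A &, forall f g, f + g \in A},
      forall a, {in A, forall f, a *: f \in A} &
      {in A &, forall f g, f * g \in A}].

Definition standard_operator_algebra (A : {pred bop}) : Prop :=
  subalgebra A /\ (forall f, finite_rank f -> f \in A).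

Record unital_std_algebra := UnitalStdAlgebra {
  usa_pred :> {pred bop} ;
  usa_std : standard_operator_algebra usa_pred ;
  usa_id : 1 \in usa_pred }.

End BoundedOperators.

Section UnitalStandardOperatorAlgebra.
Variables (K : numFieldType) (X : normedModType K) (A : unital_std_algebra X).

Fact usa_subring_closed : subring_closed A.
Proof.
have [[A0 AD AZ AM] _] := usa_std A; split; [exact: usa_id | | exact: AM].
by move=> f g Af Ag; rewrite -scaleN1r AD// AZ.
Qed.

Fact usa_scaler_closed : scaler_closed A.
Proof. by have [[]] := usa_std A. Qed.

HB.instance Definition _ :=
  GRing.isSubringClosed.Build (bop X) (usa_pred A) usa_subring_closed.
HB.instance Definition _ :=
  GRing.isScaleClosed.Build K (bop X) (usa_pred A) usa_scaler_closed.

(* The algebra A as a type of its own. *)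
Record usa_elt := USAElt { usa_val :> bop X ; usa_valP : usa_val \in A }.

HB.instance Definition _ := [isSub for usa_val].
HB.instance Definition _ := [Choice of usa_elt by <:].
HB.instance Definition _ := [SubChoice_isSubLmodule of usa_elt by <:].
HB.instance Definition _ :=
  GRing.SubZmodule_isSubPzRing.Build (bop X) (usa_pred A) usa_elt
    usa_subring_closed.

Lemma usa_valE :
  [/\ usa_val 0 = 0, usa_val 1 = 1,
      {morph usa_val : f g / f + g}, {morph usa_val : f g / f * g} &
      forall a, {morph usa_val : f / a *: f}].
Proof. by []. Qed.

Lemma usa_scalerAl a (f g : usa_elt) : a *: (f * g) = (a *: f) * g.
Proof. exact/val_inj/bop_ext. Qed.

Lemma usa_scalerAr a (f g : usa_elt) : a *: (f * g) = f * (a *: g).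
Proof. by apply/val_inj/bop_ext => x; rewrite /= linearZ. Qed.

End UnitalStandardOperatorAlgebra.

(* Main.v *)
Require Import Defs.
From HB Require Import structures.
From mathcomp Require Import all_boot all_order all_algebra.
From mathcomp Require Import complex.
From mathcomp Require Import boolp classical_sets functions reals.
From mathcomp Require Import topology normedtype.

Import Order.TTheory GRing.Theory Num.Theory.
Import numFieldNormedType.Exports.

(** Only the implications towards [delta = 0] have content, and they all pass
    through idempotents. For an idempotent [e] the element [delta e] is
    off-diagonal, [delta e = e * delta e + delta e * e], because
    [e = e * e]. On off-diagonal elements the bracket with [e] is an
    involution, so an iterated bracket [pn [:: delta e, e, .., e]] vanishes
    only if [delta e] does ([off_diagonal_pn_eq0]). Each of the conditions,
    tested on [e], [1 - e] and copies of [e], makes such an iterated bracket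
    vanish: in [Tl] and [Tr] take [a_1 = e], [a_2 = 1 - e] and
    [a_3 = .. = a_n = e], where the left-hand side is [delta 0]; for a
    centralizing map, [[delta e, e]] commutes with [e] in particular. A Lie
    [n]-centralizer satisfies [Tl], and [Nl] and [Nr] imply [Tl] and [Tr]
    since [a_1 a_2 = 0] forces [a_1 .. a_n = 0].

    It remains to see that a derivation which kills all idempotents is zero
    ([derivation_eq0]). Let [p] be an idempotent of rank one. Then
    [p + (1 - p) a p] is idempotent too, so [delta] kills [(1 - p) a p]; it
    also kills [p a p], a scalar multiple of [p]. Hence
    [delta a * p = delta (a p) - a * delta p = 0], that is, [delta a] vanishes
    on the range of [p]. Every nonzero vector [x] spans the range of such a
    [p], namely [y |-> F y *: x] for a bounded functional [F] with [F x = 1].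

    The existence of [F] is the Hahn-Banach theorem, proved here with
    sublinear functionals on the whole space instead of partially defined
    linear ones: by Zorn's lemma there is a minimal sublinear functional below
    any given one, and tilting it in a direction [y] (see [tilt]) shows that a
    minimal one is additive. A dominated real-linear [f] then yields the
    complex functional [x |-> f x - i f (i x)]. *)

Set Implicit Arguments.
Unset Strict Implicit.
Unset Printing Implicit Defensive.

Local Open Scope ring_scope.

(** * Iterated brackets with an idempotent *)

(** For [e] idempotent, with Peirce decomposition [x = x11 + x12 + x21 + x22]
    relative to [e] and [1 - e], the equation says [x11 = x22 = 0]. *)
Definition off_diagonal (A : pzRingType) (e x : A) : Prop :=
  x = e * x + x * e.

(** The bracket with [e] maps [x12 + x21] to [x21 - x12]. *)
Lemma off_diagonal_comm (A : pzRingType) (e x : A) :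
  e * e = e -> off_diagonal e x ->
  off_diagonal e (comm x e) /\ comm (comm x e) e = x.
Proof.
move=> ee xE.
(* Multiplying the hypothesis by e on both sides gives exe = exe + exe. *)
have exe : e * x * e = 0.
  have /eqP := congr1 (fun y => e * y * e) xE.
  by rewrite /= mulrDr mulrDl !mulrA ee -[e * x * e * e]mulrA ee eq_sym -subr_eq0
             addrK => /eqP.
have eC : e * comm x e = - (e * x) by rewrite mulrBr !mulrA ee exe sub0r.
have Ce : comm x e * e = x * e by rewrite mulrBl -mulrA ee exe subr0.
split; first by rewrite /off_diagonal eC Ce addrC.
by rewrite {1}/comm eC Ce opprK addrC.
Qed.

Lemma off_diagonal_pn_eq0 (A : pzRingType) (e x : A) (k : nat) :
  e * e = e -> off_diagonal e x -> pn (x :: nseq k e) = 0 -> x = 0.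
Proof.
move=> ee; elim: k x => [//|k IH] x xE /= x0.
have [yE yK] := off_diagonal_comm ee xE.
by rewrite -yK (IH _ yE x0) /comm mul0r mulr0 subr0.
Qed.

(** * Conditions that force a derivation to vanish on idempotents *)

Lemma pn0s (A : pzRingType) (s : seq A) : pn (0 :: s) = 0.
Proof. by elim: s => //= a s; rewrite /comm mul0r mulr0 subr0. Qed.

Lemma pn_cons2 (A : pzRingType) (a b : A) (s : seq A) :
  pn [:: a, b & s] = pn (comm a b :: s).
Proof. by []. Qed.

Lemma commxx (A : pzRingType) (a : A) : comm a a = 0.
Proof. by rewrite /comm subrr. Qed.

Lemma derivation1 (A : pzRingType) (D : A -> A) : derivation D -> D 1 = 0.
Proof.
move=> dD; have /eqP := dD 1 1.
by rewrite mul1r mul1r mulr1 -subr_eq0 opprD addNKr oppr_eq0 => /eqP.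
Qed.

(** Differentiating [e = e * e] shows that [D e] is off-diagonal. *)
Lemma derivation_idem_eq0 (A : pzRingType) (D : A -> A) (e : A) (k : nat) :
  derivation D -> e * e = e -> pn (D e :: nseq k e) = 0 -> D e = 0.
Proof.
by move=> dD ee; apply: off_diagonal_pn_eq0 => //; rewrite /off_diagonal -dD ee.
Qed.

Lemma mul_idem_compl (A : pzRingType) (e : A) : e * e = e -> e * (1 - e) = 0.
Proof. by move=> ee; rewrite mulrBr mulr1 ee subrr. Qed.

Lemma comm_compl (A : pzRingType) (a b : A) : comm a (1 - b) = - comm a b.
Proof.
by rewrite /comm mulrBr mulrBl mul1r mulr1 !opprB addrC addrA subrK.
Qed.

Lemma comm_anti (A : pzRingType) (a b : A) : comm a b = - comm b a.
Proof. by rewrite /comm opprB. Qed.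

Lemma pn_oppr (A : pzRingType) (a : A) (s : seq A) :
  pn (- a :: s) = - pn (a :: s).
Proof.
elim: s a => //= b s IH a.
by rewrite -IH /comm mulNr mulrN opprD opprK.
Qed.

(** The instance [a_1 = e], [a_2 = 1 - e], [a_3 = .. = a_n = e] of the
    condition has [p_n (a_1, .., a_n) = 0]; as [[D e, 1 - e] = - [D e, e]], its
    other side is an iterated bracket of [D e] with [e], up to sign. *)
Lemma Tl_idem_eq0 (A : pzRingType) (D : {additive A -> A}) (n : nat) (e : A) :
  derivation D -> Tl n D -> e * e = e -> D e = 0.
Proof.
move=> dD TD ee; apply: (derivation_idem_eq0 (k := n.-2.+1) dD ee).
have := TD e (1 - e) (nseq_tuple n.-2 e) (mul_idem_compl ee).
rewrite !pn_cons2 !comm_compl commxx oppr0 pn0s raddf0 pn_oppr.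
by move=> /esym/eqP; rewrite oppr_eq0 => /eqP.
Qed.

(** Same instance as for [Tl_idem_eq0], with [[e, D (1 - e)] = [D e, e]]. *)
Lemma Tr_idem_eq0 (A : pzRingType) (D : {additive A -> A}) (n : nat) (e : A) :
  derivation D -> Tr n D -> e * e = e -> D e = 0.
Proof.
move=> dD TD ee; apply: (derivation_idem_eq0 (k := n.-2.+1) dD ee).
have := TD e (1 - e) (nseq_tuple n.-2 e) (mul_idem_compl ee).
rewrite raddfB derivation1// sub0r !pn_cons2 comm_compl commxx oppr0 pn0s raddf0.
have -> : comm e (- D e) = comm (D e) e.
  by rewrite /comm mulrN mulNr opprK addrC.
by [].
Qed.

(** [[D e, e]] commutes with [e], so the double bracket of [D e] with [e]
    vanishes. *)
Lemma centralizing_idem_eq0 (A : pzRingType) (D : A -> A) (e : A) :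
  derivation D -> centralizing D -> e * e = e -> D e = 0.
Proof.
move=> dD cD ee; apply: (derivation_idem_eq0 (k := 2) dD ee).
by rewrite /= {1}/comm cD subrr.
Qed.

Lemma Lie_n_centralizer_Tl (A : pzRingType) (n : nat) (phi : A -> A) :
  (2 <= n)%N -> Lie_n_centralizer n phi -> Tl n phi.
Proof. by case: n => [|[|n]]// _ H a1 a2 s _; exact: (H a1 [tuple of a2 :: s]). Qed.

(** * Derivations that vanish on idempotents *)

Lemma idem_shear (A : pzRingType) (p a : A) :
  p * p = p -> let e := p + (1 - p) * a * p in e * e = e.
Proof.
move=> pp /=; have pq := mul_idem_compl pp.
rewrite mulrDl !mulrDr pp -[X in _ + (X + _)]mulrA pp.
rewrite -![(1 - p) * a * p * _]mulrA !(mulrA p) pq !mul0r !mulr0 !addr0.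
by [].
Qed.

(** [a p = p a p + (1 - p) a p], and [(1 - p) a p] is the difference of the
    idempotents [p + (1 - p) a p] and [p]. The assumption on [p a p] is
    automatic when [p] has rank one. *)
Lemma derivation_mul_idem_eq0 (A : pzRingType) (D : {additive A -> A}) (p a : A) :
  derivation D -> (forall e, e * e = e -> D e = 0) -> p * p = p ->
  D (p * a * p) = 0 -> D a * p = 0.
Proof.
move=> dD De pp Dpap.
have Dp := De p pp.
have Dqap : D ((1 - p) * a * p) = 0.
  have := De _ (idem_shear a pp); rewrite raddfD /= Dp add0r //.
have apE : a * p = p * a * p + (1 - p) * a * p.
  by rewrite mulrBl mulrBl mul1r addrC subrK.
have := dD a p; rewrite Dp mulr0 add0r => <-.
by rewrite apE raddfD /= Dpap Dqap addr0.
Qed.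

(** * The Hahn-Banach theorem over the reals *)

Lemma scalarE (K : pzRingType) (V : lmodType K) (f : V -> K) :
  scalar f ->
  [/\ f 0 = 0, {morph f : x y / x + y}, {morph f : x / - x} &
      forall a x, f (a *: x) = a * f x].
Proof.
move=> fl.
have fD : {morph f : x y / x + y}.
  by move=> x y; have := fl 1 x y; rewrite scale1r mul1r.
have f0 : f 0 = 0 by apply: (addrI (f 0)); rewrite -fD !addr0.
have fZ a x : f (a *: x) = a * f x by have := fl a x 0; rewrite f0 !addr0.
by split=> // x; rewrite -scaleN1r fZ mulN1r.
Qed.

Definition sublinear (R : realType) (V : lmodType R) (q : V -> R) : Prop :=
  (forall x y, q (x + y) <= q x + q y) /\
  (forall t x, 0 <= t -> q (t *: x) <= t * q x).

Lemma sublinear0 (R : realType) (V : lmodType R) (q : V -> R) :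
  sublinear q -> q 0 = 0.
Proof.
move=> [qD qZ]; apply/eqP; rewrite eq_le; apply/andP; split.
  by have := qZ 0 0 (lexx _); rewrite scale0r mul0r.
by have := qD 0 0; rewrite addr0 -{1}[q 0]add0r lerD2r.
Qed.

Lemma sublinearZ (R : realType) (V : lmodType R) (q : V -> R) (t : R) (x : V) :
  sublinear q -> 0 <= t -> q (t *: x) = t * q x.
Proof.
move=> sq t0; have [_ qZ] := sq.
have [->|tN0] := eqVneq t 0; first by rewrite scale0r mul0r (sublinear0 sq).
have tgt0 : 0 < t by rewrite lt_def tN0.
apply/eqP; rewrite eq_le qZ//= -ler_pdivlMl//.
have := qZ t^-1 (t *: x); rewrite scalerA mulVf// scale1r; apply.
by rewrite invr_ge0.
Qed.

Lemma sublinearN (R : realType) (V : lmodType R) (q : V -> R) (x : V) :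
  sublinear q -> - q (- x) <= q x.
Proof.
move=> sq; have [qD _] := sq.
by rewrite lerNl -subr_ge0 opprK -(sublinear0 sq) -(addNr x).
Qed.

Definition pointwise_inf (R : realType) (V : Type) (F : set (V -> R)) (x : V) : R :=
  inf [set g x | g in F]%classic.

Lemma pointwise_inf_le (R : realType) (V : Type) (F : set (V -> R)) (b : V -> R)
    (g : V -> R) (x : V) :
  (forall h y, F h -> b y <= h y) -> F g -> pointwise_inf F x <= g x.
Proof.
move=> bF Fg; apply: ge_inf; last by exists g.
by exists (b x) => _ [h Fh <-]; exact: bF.
Qed.

Lemma le_pointwise_inf (R : realType) (V : Type) (F : set (V -> R)) (x : V) (c : R) :
  (exists g, F g) -> (forall g, F g -> c <= g x) -> c <= pointwise_inf F x.
Proof.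
move=> [g Fg] cF; apply: lb_le_inf; first by exists (g x), g.
by move=> _ [h Fh <-]; exact: cF.
Qed.

(** The closure conditions on [F] hold both for chains of sublinear functionals,
    where [k] is the smaller of [g] and [h], and for the family that defines
    [tilt]. *)
Lemma pointwise_inf_sublinear (R : realType) (V : lmodType R) (F : set (V -> R))
    (b : V -> R) :
  (exists g, F g) -> (forall g x, F g -> b x <= g x) ->
  (forall g h x y, F g -> F h -> exists2 k, F k & k (x + y) <= g x + h y) ->
  (forall g t x, F g -> 0 <= t -> exists2 k, F k & k (t *: x) <= t * g x) ->
  sublinear (pointwise_inf F).
Proof.
move=> F0 bF FD FZ; split=> [x y|t x t0].
  rewrite -lerBlDr; apply: le_pointwise_inf => // g Fg.
  rewrite lerBlDl -lerBlDr; apply: le_pointwise_inf => // h Fh.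
  rewrite lerBlDr [in leRHS]addrC; have [k Fk kgh] := FD g h x y Fg Fh.
  apply: (le_trans _ kgh); exact: (pointwise_inf_le _ bF Fk).
have le_g g : F g -> pointwise_inf F (t *: x) <= t * g x.
  move=> Fg; have [k Fk kg] := FZ g t x Fg t0.
  apply: (le_trans _ kg); exact: (pointwise_inf_le _ bF Fk).
(* For t = 0 the bound tested on any member of F reads: the infimum at 0 is
   nonpositive. *)
have [t00|tN0] := eqVneq t 0.
  by have [g Fg] := F0; have := le_g g Fg; rewrite t00 !mul0r.
have tgt0 : 0 < t by rewrite lt_def tN0.
rewrite -ler_pdivrMl//; apply: le_pointwise_inf => // g Fg.
by rewrite ler_pdivrMl// le_g.
Qed.

(** The largest sublinear functional [r] below [q] with [r (- y) <= - q y]: as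
    [r y <= q y] too, such an [r] is linear on the line through [y]. *)
Definition tilt (R : realType) (V : lmodType R) (q : V -> R) (y : V) : V -> R :=
  pointwise_inf
    [set g | exists2 t, 0 <= t & g = fun x => q (x + t *: y) - t * q y]%classic.

Lemma tilt_sublinear (R : realType) (V : lmodType R) (q : V -> R) (y : V) :
  sublinear q ->
  sublinear (tilt q y) /\
  forall t x, 0 <= t -> tilt q y x <= q (x + t *: y) - t * q y.
Proof.
move=> sq; have [qD qZ] := sq.
have bF g x : (exists2 t, 0 <= t & g = fun x => q (x + t *: y) - t * q y) ->
    - q (- x) <= g x.
  move=> [t t0 ->]; rewrite lerBrDr addrC lerBlDr -sublinearZ//.
  by rewrite (le_trans _ (qD _ _))// addrAC subrr add0r.
split; last first.
  move=> t x t0.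
  apply: (pointwise_inf_le (g := fun x => q (x + t *: y) - t * q y) _ bF).
  by exists t.
apply: (pointwise_inf_sublinear (b := fun x => - q (- x))).
- by exists (fun x => q (x + 0 *: y) - 0 * q y), 0.
- exact: bF.
- move=> _ _ x z [s s0 ->] [t t0 ->].
  exists (fun x => q (x + (s + t) *: y) - (s + t) * q y).
    by exists (s + t) => //; exact: addr_ge0.
  rewrite scalerDl mulrDl opprD [in leRHS]addrACA lerD2r.
  by rewrite addrACA qD.
- move=> _ s x [t t0 ->] s0.
  exists (fun x => q (x + (s * t) *: y) - (s * t) * q y).
    by exists (s * t) => //; exact: mulr_ge0.
  by rewrite mulrBr mulrA lerD2r -scalerA -scalerDr qZ.
Qed.

(** Zorn's lemma for the reversed pointwise order on the sublinear functionals
    below [p]: chains have an infimum, since [- p (- x)] bounds at [x] all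
    sublinear functionals below [p]. *)
Lemma exists_minimal_sublinear (R : realType) (V : lmodType R) (p : V -> R) :
  sublinear p ->
  exists q, [/\ sublinear q, forall x, q x <= p x &
    forall r, sublinear r -> (forall x, r x <= q x) -> r = q].
Proof.
move=> sp.
pose T := {q : V -> R | sublinear q /\ forall x, q x <= p x}.
have mk q : sublinear q -> (forall x, q x <= p x) -> exists t : T, sval t = q.
  by move=> sq qp; exists (exist _ q (conj sq qp)).
pose below (s t : T) := `[< forall x, sval t x <= sval s x >].
have [|r s t /asboolP rs /asboolP st|s t /asboolP st /asboolP ts|C totC|[q [sq qp]] qmin] :=
  @Zorn T below.
- by move=> t; apply/asboolP.
- by apply/asboolP => x; rewrite (le_trans (st x)).
- move: s t st ts => [s ps] [t pt] /= st ts; apply: eq_exist.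
  by apply/funext => x; apply/eqP; rewrite eq_le st ts.
- have [C0|/forallNP C0] := pselect (exists t, C t); last first.
    by have [t _] := mk _ sp (fun x => lexx (p x)); exists t => s /C0.
  pose F : set (V -> R) := [set sval t | t in C]%classic.
  have bF g x : F g -> - p (- x) <= g x.
    move=> [[h [sh hp]] _ <-] /=.
    by rewrite (le_trans _ (sublinearN x sh))// lerN2.
  have sF : sublinear (pointwise_inf F).
    apply: (pointwise_inf_sublinear (b := fun x => - p (- x))) => //.
    - by have [t Ct] := C0; exists (sval t), t.
    - move=> _ _ x y [s Cs <-] [t Ct <-].
      have [/asboolP st|/asboolP ts] := totC s t Cs Ct.
        exists (sval t); first by exists t.
        by have [[tD _] _] := svalP t; rewrite (le_trans (tD _ _))// lerD2r.
      exists (sval s); first by exists s.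
      by have [[sD _] _] := svalP s; rewrite (le_trans (sD _ _))// lerD2l.
    - move=> _ a x [t Ct <-] a0; exists (sval t); first by exists t.
      by have [[_ tZ] _] := svalP t; exact: tZ.
  have leF t x : C t -> pointwise_inf F x <= sval t x.
    by move=> Ct; apply: (pointwise_inf_le _ bF); exists t.
  have Fp x : pointwise_inf F x <= p x.
    have [t Ct] := C0; rewrite (le_trans (leF t x Ct))//.
    by have [_] := svalP t.
  have [t tE] := mk _ sF Fp.
  by exists t => s Cs; apply/asboolP => x; rewrite tE leF.
exists q; split=> // r sr rq.
have rp x : r x <= p x by rewrite (le_trans (rq x)).
have [t tE] := mk _ sr rp.
by rewrite -tE (qmin t)//; apply/asboolP => x /=; rewrite tE.
Qed.

(** Minimality gives [tilt q y = q], hence [q x <= q (x + y) - q y], the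
    converse of subadditivity. *)
Lemma minimal_sublinear_linear (R : realType) (V : lmodType R) (q : V -> R) :
  sublinear q ->
  (forall r, sublinear r -> (forall x, r x <= q x) -> r = q) ->
  scalar q.
Proof.
move=> sq qmin; have [qD _] := sq.
have qDE x y : q (x + y) = q x + q y.
  have [st tq] := tilt_sublinear y sq.
  have tE : tilt q y = q.
    by apply: qmin => // z; rewrite (le_trans (tq 0 z _))// scale0r addr0 mul0r subr0.
  apply/eqP; rewrite eq_le qD /= -lerBrDr.
  by have := tq 1 x ler01; rewrite tE scale1r mul1r.
have qN x : q (- x) = - q x.
  by apply/eqP; rewrite -addr_eq0 -qDE addNr (sublinear0 sq).
move=> a x y; rewrite qDE; congr (_ + _).
have [a0|/ltW a0] := leP 0 a; first exact: sublinearZ.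
by rewrite -[a]opprK scaleNr qN sublinearZ ?oppr_ge0// !mulNr.
Qed.

(** A minimal functional [f] below [tilt p x0] has [f (- x0) <= - p x0], so that
    the domination [f <= p] becomes an equality at [x0]. *)
Lemma exists_dominated_linear (R : realType) (V : lmodType R) (p : V -> R) (x0 : V) :
  sublinear p ->
  exists f : V -> R, [/\ scalar f, forall x, f x <= p x & f x0 = p x0].
Proof.
move=> sp; have [st tp] := tilt_sublinear x0 sp.
have [f [sf ft fmin]] := exists_minimal_sublinear st.
have flin := minimal_sublinear_linear sf fmin.
have fp x : f x <= p x.
  by rewrite (le_trans (ft x))// (le_trans (tp 0 x _))// scale0r addr0 mul0r subr0.
exists f; split=> //; apply/eqP; rewrite eq_le fp /=.
have [_ _ fN _] := scalarE flin.
rewrite -lerN2 -fN (le_trans (ft _))// (le_trans (tp 1 _ ler01))//.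
by rewrite scale1r mul1r addNr (sublinear0 sp) sub0r.
Qed.

(** * Bounded functionals on complex normed spaces *)

Local Open Scope complex_scope.

(** A separate name for the same carrier, so that the real scaling below does
    not compete with the complex one on [V]. *)
Definition realification (R : realType) (V : lmodType R[i]) : Type := V.

HB.instance Definition _ (R : realType) (V : lmodType R[i]) :=
  GRing.Zmodule.on (realification V).

Definition real_scale (R : realType) (V : lmodType R[i]) (r : R)
  (x : realification V) : realification V := (r%:C *: (x : V)).

Fact real_scaleA (R : realType) (V : lmodType R[i]) (a b : R)
  (x : realification V) : real_scale a (real_scale b x) = real_scale (a * b) x.
Proof. by rewrite /real_scale scalerA rmorphM. Qed.

Fact real_scale1 (R : realType) (V : lmodType R[i]) :
  left_id 1 (@real_scale R V).
Proof. by move=> x; rewrite /real_scale rmorph1 scale1r. Qed.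

Fact real_scaleDr (R : realType) (V : lmodType R[i]) :
  right_distributive (@real_scale R V) +%R.
Proof. by move=> a x y; rewrite /real_scale scalerDr. Qed.

Fact real_scaleDl (R : realType) (V : lmodType R[i]) (x : realification V) :
  {morph (@real_scale R V)^~ x : a b / a + b}.
Proof. by move=> a b; rewrite /real_scale rmorphD scalerDl. Qed.

HB.instance Definition _ (R : realType) (V : lmodType R[i]) :=
  GRing.Zmodule_isLmodule.Build R (realification V)
    (@real_scaleA R V) (@real_scale1 R V) (@real_scaleDr R V) (@real_scaleDl R V).

Lemma real_scaleE (R : realType) (V : lmodType R[i]) (r : R) (x : V) :
  r *: (x : realification V) = r%:C *: x :> V.
Proof. by []. Qed.

(** A complex functional [G] satisfies [Im (G x) = - Re (G (i x))], so this is the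
    only one with real part [f]. *)
Lemma complexification_linear (R : realType) (V : lmodType R[i])
    (f : realification V -> R) :
  scalar f -> scalar (fun x : V => f x -i* f ('i *: (x : V))).
Proof.
move=> /scalarE[_ fDr fNr fZr].
have fD (x y : V) : f (x + y) = f x + f y by exact: fDr.
have fN (x : V) : f (- x) = - f x by exact: fNr.
have fZ (a : R) (x : V) : f (a%:C *: x) = a * f x by exact: fZr.
have fC (c : R[i]) (x : V) : f (c *: x) = complex.Re c * f x + complex.Im c * f ('i *: x).
  by rewrite {1}[c]complexE scalerDl fD mulrC -scalerA !fZ.
move=> c x y; rewrite /= !scalerDr !fD scalerA ['i * c]mulrC -scalerA.
rewrite (fC c x) (fC c ('i *: x)) scalerA -expr2 sqr_i scaleN1r fN.
case: c => a b; apply/eqP; rewrite eq_complex /=; apply/andP; split; apply/eqP.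
  by rewrite mulrN opprK.
by rewrite !opprD !mulrN opprK.
Qed.

Lemma norm_Re (R : realType) (V : normedModType R[i]) (x : V) :
  `|x| = (complex.Re `|x|)%:C.
Proof. by rewrite RRe_real// normr_real. Qed.

(** Hahn-Banach for the norm, viewed as a sublinear functional on the underlying
    real space, gives a real functional [f] with [f x0 = `|x0|]; its
    complexification [G] is bounded and nonzero at [x0]. *)
Lemma exists_bounded_functional (R : realType) (X : normedModType R[i]) (x0 : X) :
  x0 != 0 ->
  exists F : X -> R[i],
    [/\ scalar F, exists M, forall x, `|F x| <= M * `|x| & F x0 = 1].
Proof.
move=> x0N0; pose p (x : realification X) : R := complex.Re `|x : X|.
have sp : sublinear p.
  split=> [x y|t x t0].
    rewrite /p -lecR rmorphD /= -!norm_Re. exact: ler_normD.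
  rewrite /p -lecR rmorphM /= -!norm_Re.
  by rewrite real_scaleE normrZ ger0_norm// ler0c.
have [f [fl fp fx0]] := @exists_dominated_linear R (realification X) p x0 sp.
pose G (x : X) := f x -i* f ('i *: x).
have Gl := complexification_linear fl.
have normrC (a : R) : `|a%:C| = `|a|%:C.
  by rewrite normc_def /= expr0n addr0 sqrtr_sqr.
have fb (x : X) : `|(f x)%:C| <= `|x : X|.
  have [_ _ fN _] := scalarE fl.
  rewrite normrC norm_Re lecR ler_norml fp andbT lerNl -fN.
  by have := fp (- x); rewrite /p normrN.
have normi : `|'i : R[i]| = 1.
  by rewrite normc_def /= expr0n add0r expr1n sqrtr1.
have Gx0 : G x0 != 0.
  apply: contra x0N0 => /eqP/(congr1 (@complex.Re R)) /= f0.
  by rewrite -normr_eq0 norm_Re -/(p x0) -fx0 f0.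
exists (fun x => G x / G x0); split.
- by move=> a x y; rewrite [G (_ + _)]Gl mulrDl mulrA.
- exists (2 / `|G x0|) => x; rewrite normrM normfV mulrAC.
  rewrite ler_wpM2r ?invr_ge0//.
  rewrite [G x]complexE (le_trans (ler_normD _ _))//= normrM normi mul1r.
  rewrite mulr_natl mulr2n lerD ?fb// rmorphN normrN.
  by rewrite (le_trans (fb _))// normrZ normi mul1r.
- by rewrite divff.
Qed.

(** * Derivations of standard operator algebras *)

Lemma exists_rank_one_bop (K : numFieldType) (X : normedModType K)
    (F : X -> K) (v : X) :
  scalar F -> (exists M, forall x, `|F x| <= M * `|x|) ->
  exists2 P : bop X, finite_rank P & forall y, P y = F y *: v.
Proof.
move=> Fl [M FM].
have PP : (fun y => F y *: v) \in @bop_pred K X.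
  apply/asboolP; split; first by move=> a x y; rewrite Fl scalerDl scalerA.
  exists (M * `|v|) => y; rewrite normrZ mulrAC.
  by rewrite ler_wpM2r.
exists (BOp PP) => //; exists 1%N, (fun=> v) => y.
by exists (fun=> F y); rewrite big_ord1.
Qed.

(** With [p] the rank one projection [y |-> F y *: x], [p a p = F (a x) *: p],
    so that [delta a * p = 0]; evaluate at [x]. *)
Lemma derivation_eq0 (R : realType) (X : normedModType R[i])
    (U : unital_std_algebra X) (delta : {linear usa_elt U -> usa_elt U}) :
  derivation delta -> (forall e, e * e = e -> delta e = 0) ->
  forall a, delta a = 0.
Proof.
move=> dD De a; apply/val_inj/bop_ext => x.
have [->|x0] := eqVneq x 0; first by rewrite !linear0.
have [F [Fl Fb Fx]] := exists_bounded_functional x0.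
have [P Pfin PE] := exists_rank_one_bop x Fl Fb.
have [_ FU] := usa_std U; pose p := USAElt (FU P Pfin).
have [_ _ _ FZ] := scalarE Fl.
have pp : p * p = p.
  apply/val_inj/bop_ext => y /=.
  by rewrite /= !PE FZ Fx mulr1.
have pap : p * a * p = F (a x) *: p.
  apply/val_inj/bop_ext => y /=.
  by rewrite -[RHS]/(F (a x) *: P y) !PE linearZ FZ scalerA mulrC.
have dpap : delta (p * a * p) = 0 by rewrite pap linearZ /= (De p pp) scaler0.
have ap0 : delta a * p = 0 by exact: derivation_mul_idem_eq0 pp dpap.
have := congr1 (fun b : usa_elt U => b x) ap0.
by rewrite /= PE Fx scale1r.
Qed.

Theorem theorem4p5 (R : realType) (X : completeNormedModType R[i])
    (dimX : dim_ge X 2) (U : unital_std_algebra X) (n : nat) (hn : (2 <= n)%N)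
    (delta : {linear usa_elt U -> usa_elt U}) (hdelta : derivation delta) :
  [<-> Lie_n_centralizer n delta;
       Tl n delta /\ Tr n delta;
       Tl n delta;
       Tr n delta;
       Nl n delta /\ Nr n delta;
       Nl n delta;
       Nr n delta;
       n_commuting n delta;
       commuting delta;
       centralizing delta;
       forall a, delta a = 0].
Proof.
have idem0 : (forall e, e * e = e -> delta e = 0) -> forall a, delta a = 0.
  exact: derivation_eq0.
have Tl0 : Tl n delta -> forall a, delta a = 0.
  by move=> H; apply: idem0 => e; exact: Tl_idem_eq0 H.
have Tr0 : Tr n delta -> forall a, delta a = 0.
  by move=> H; apply: idem0 => e; exact: Tr_idem_eq0 H.
have l0 (a1 a2 : usa_elt U) (s : seq (usa_elt U)) : (forall a, delta a = 0) ->
    delta (pn [:: a1, a2 & s]) = pn [:: delta a1, a2 & s].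
  by move=> d0; rewrite !d0 pn0s.
have r0 (a1 a2 : usa_elt U) (s : seq (usa_elt U)) : (forall a, delta a = 0) ->
    delta (pn [:: a1, a2 & s]) = pn [:: a1, delta a2 & s].
  by move=> d0; rewrite !d0 pn_cons2 comm_anti /comm mul0r mulr0 subrr oppr0 pn0s.
have NTl : Nl n delta -> Tl n delta.
  by move=> H a1 a2 s a0; apply: H; rewrite !big_cons mulrA a0 mul0r.
have NTr : Nr n delta -> Tr n delta.
  by move=> H a1 a2 s a0; apply: H; rewrite !big_cons mulrA a0 mul0r.
tfae.
- move=> H; suff d0 : forall a, delta a = 0.
    by split=> a1 a2 s _; [exact: l0|exact: r0].
  exact/Tl0/Lie_n_centralizer_Tl.
- by case.
- by move=> /Tl0 d0 a1 a2 s _; exact: r0.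
- by move=> /Tr0 d0; split=> a1 a2 s _; [exact: l0|exact: r0].
- by case.
- by move=> /NTl/Tl0 d0 a1 a2 s _; exact: r0.
- by move=> /NTr/Tr0 d0 a; rewrite d0 pn0s.
- move=> H; suff d0 : forall a, delta a = 0.
    by move=> a; rewrite d0 /comm mul0r mulr0 subrr.
  apply: idem0 => e ee; exact: (derivation_idem_eq0 hdelta ee (H e)).
- by move=> H a b; rewrite H mul0r mulr0.
- by move=> H; apply: idem0 => e; exact: centralizing_idem_eq0.
- by move=> d0 a s; rewrite !d0 pn0s.
Qed.
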